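(* Let $L$ be a compactly generated multiplicative lattice in which the top element $1$ is compact and every finite product of compact elements is compact, and suppose $L$ is a $szi$-multiplicative lattice. An element $q$ of $L$ is $z$-semiprime if and only if $q$ is a $z$-element and also a semiprime element of $L$.
   Context: A multiplicative lattice is a complete lattice $(L,\leqslant,0,1)$ endowed with an associative, commutative multiplication which distributes over arbitrary joins and has $1$ as multiplicative identity. An element $c\in L$ is compact if for any $\{x_\lambda\}_{\lambda\in\Lambda}\subseteq L$, $c\leqslant\bigvee_{\lambda\in\Lambda}x_\lambda$ implies $c\leqslant\bigvee_{i=1}^n x_{\lambda_i}$ for some $n\in\mathbb{N}^+$ and $\lambda_1,\dots,\lambda_n\in\Lambda$; $L$ is compactly generated if every element of $L$ is a join of compact elements. An element $x$ is proper if $x\neq 1$. A proper element $m$ is maximal if $m\leqslant x$ and $x<1$ imply $m=x$, for all $x\in L$; $\mathcal{M}(L)$ is the set of maximal elements. A proper element $q$ is semiprime if for all $a\in L$, $a^2\leqslant q$ implies $a\leqslant q$. For $a\in L$ put $\mathcal{M}_a=\{m\in\mathcal{M}(L)\mid a\leqslant m\}$ and $\mathsf{m}_a=\bigwedge\mathcal{M}_a$ (the empty meet is $1$). An element $x\in L$ is a $z$-element if for all $a,b\in L$, $\mathcal{M}_a=\mathcal{M}_b$ and $b\leqslant x$ imply $a\leqslant x$. $L$ is a $szi$-multiplicative lattice if $(\mathsf{m}_a)^2=\mathsf{m}_a$ for every $a\in L$. A proper $z$-element $p$ is $z$-semiprime if for all $z$-elements $a$ of $L$, $a^2\leqslant p$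 implies $a\leqslant p$. *)

(* Defs.v *)
From HB Require Import structures.
From mathcomp Require Import all_boot all_order.
From mathcomp Require Import boolp classical_sets.

Set Implicit Arguments.
Unset Strict Implicit.
Unset Printing Implicit Defensive.

Import Order.TTheory.
Local Open Scope classical_set_scope.
Local Open Scope order_scope.

HB.mixin Record isCompleteLattice d L of Order.TBLattice d L := {
  bigjoin : set L -> L;
  bigmeet : set L -> L;
  bigjoinP : forall A : set L, supremums A (bigjoin A);
  bigmeetP : forall A : set L, infimums A (bigmeet A)
}.

#[short(type="completeLatticeType")]
HB.structure Definition CompleteLattice d :=
  { L of isCompleteLattice d L & Order.TBLattice d L }.

HB.mixin Record isMultLattice d L of CompleteLattice d L := {
  mlmul : L -> L -> L;
  mlmulA : associative mlmul;
  mlmulC : commutative mlmul;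
  mlmul1x : left_id (\top : L) mlmul;
  mlmul_bigjoinr : forall (x : L) (A : set L),
    mlmul x (bigjoin A) = bigjoin [set mlmul x a | a in A]
}.

(* The trivial lattice, where \bot = \top, is not excluded. *)
#[short(type="multLatticeType")]
HB.structure Definition MultLattice d :=
  { L of isMultLattice d L & CompleteLattice d L }.

HB.instance Definition _ d (L : multLatticeType d) :=
  Monoid.isComLaw.Build L (\top : L) (@mlmul d L)
    (@mlmulA d L) (@mlmulC d L) (@mlmul1x d L).

Section MultLatticeTheory.
Context {d : Order.disp_t} {L : multLatticeType d}.
Implicit Types (a b c m p q x : L).

(* Families are nonempty: the finite subfamily must have at least one member,
   so the empty family would prevent \bot from being compact. *)
Definition compact_elt c : Prop :=
  forall (I : Type) (x : I -> L), inhabited I ->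
    c <= bigjoin (range x) ->
    exists (n : nat) (i : 'I_n.+1 -> I), c <= \join_(k < n.+1) x (i k).

Definition proper_elt x : Prop := x <> \top.

Definition maximal_elt m : Prop :=
  proper_elt m /\ forall x, m <= x -> x < \top -> m = x.

Definition semiprime_elt q : Prop :=
  proper_elt q /\ forall a, mlmul a a <= q -> a <= q.

Definition max_above a : set L := [set m | maximal_elt m /\ a <= m].

Definition max_meet a : L := bigmeet (max_above a).

Definition z_elt x : Prop :=
  forall a b, max_above a = max_above b -> b <= x -> a <= x.

Definition z_semiprime_elt p : Prop :=
  [/\ proper_elt p, z_elt p
    & forall a, z_elt a -> mlmul a a <= p -> a <= p].

End MultLatticeTheory.

Definition compactly_generated d (L : multLatticeType d) : Prop :=
  forall x : L, exists2 A : set L, A `<=` compact_elt & x = bigjoin A.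

Definition compact_prod_closed d (L : multLatticeType d) : Prop :=
  forall s : seq L, (forall c, c \in s -> compact_elt c) ->
    compact_elt (\big[mlmul/(\top : L)]_(c <- s) c).

Definition szi_lattice d (L : multLatticeType d) : Prop :=
  forall a : L, mlmul (max_meet a) (max_meet a) = max_meet a.

(* Main.v *)
Require Import Defs.
From mathcomp Require Import all_boot all_order.
From mathcomp Require Import boolp classical_sets.

(** If [m] is maximal, [a^2 <= m] and [a] is not below [m], then [a \/ m = 1],
    so [a = a (a \/ m) = a^2 \/ a m <= m]; hence maximal elements are semiprime.
    Thus [a^2] and [a] lie below the same maximal elements, and a [z]-element
    above [a^2] is above [a]: every proper [z]-element is semiprime. *)

Import Order.TTheory.
Local Open Scope classical_set_scope.
Local Open Scope order_scope.

Lemma bigjoin_set2 (d : Order.disp_t) (L : completeLatticeType d) (a b : L) :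
  bigjoin [set a; b] = a `|` b.
Proof.
have [ub least] := bigjoinP [set a; b].
apply/le_anti/andP; split.
  by apply: least => x [->|->]; [exact: leUl | exact: leUr].
by rewrite leUx; apply/andP; split; apply: ub; [left | right].
Qed.

Section MultLattice.
Context {d : Order.disp_t} {L : multLatticeType d}.
Implicit Types a b m q x : L.

(** The two-element case of distributivity over arbitrary joins. *)
Lemma mlmulUr x a b : mlmul x (a `|` b) = mlmul x a `|` mlmul x b.
Proof. by rewrite -!bigjoin_set2 mlmul_bigjoinr image_setU !image_set1. Qed.

Lemma mlmulx1 a : mlmul a \top = a.
Proof. by rewrite mlmulC mlmul1x. Qed.

(** As [1 = a \/ 1], distributivity gives [b = b a \/ b]. *)
Lemma mlmul_ler a b : mlmul a b <= b.
Proof.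
have := leUl (mlmul b a) (mlmul b \top).
by rewrite -mlmulUr joinx1 mlmulx1 mlmulC.
Qed.

Lemma maximal_semiprime m : maximal_elt m -> semiprime_elt m.
Proof.
move=> [m1 mmax]; split=> // a aam.
have [am1|am1] := eqVneq (a `|` m) \top.
  by rewrite -[a]mlmulx1 -am1 mlmulUr leUx aam mlmul_ler.
(* Otherwise [a \/ m] is proper and above [m], so maximality gives [m = a \/ m]. *)
by rewrite (mmax (a `|` m)) ?leUr ?leUl ?lt_neqAle ?am1 ?lex1.
Qed.

Lemma max_above_sqr a : max_above (mlmul a a) = max_above a.
Proof.
apply/seteqP; split=> m [mmax am]; split=> //.
  by have [_] := maximal_semiprime _ mmax; apply.
by rewrite (le_trans (mlmul_ler a a)).
Qed.

Lemma z_elt_semiprime q : proper_elt q -> z_elt q -> semiprime_elt q.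
Proof.
(* The [z]-property is applied to the pair [a], [a^2]. *)
move=> q1 qz; split=> // a; apply: qz.
by rewrite max_above_sqr.
Qed.

End MultLattice.

Theorem proposition5p9 (d : Order.disp_t) (L : multLatticeType d)
    (hgen : compactly_generated L)
    (htop : compact_elt (\top%O : L))
    (hprod : compact_prod_closed L)
    (hszi : szi_lattice L)
    (q : L) :
  z_semiprime_elt q <-> z_elt q /\ semiprime_elt q.
Proof.
split=> [[q1 qz _]|[qz [q1 qsp]]]; first by split=> //; exact: z_elt_semiprime.
(* Semiprimality covers every [a], in particular the [z]-elements. *)
by split=> // a _; exact: qsp.
Qed.
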